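(* Let $\Phi_P := \{ \mathbf{x} \in \mathbb{R}^2 \mid A\mathbf{x} - \mathbf{b} \in \mathcal{Q}^3 \}$ and $f(\mathbf{x}) = x_1 + x_2$ for $\mathbf{x} = (x_1,x_2)\in\mathbb{R}^2$. The linear image of $\Phi_P$ under $f$ is not closed in $\mathbb{R}$. Specifically, $$f(\Phi_P) = (0,\infty).$$
   Context: The linear operator $A:\mathbb{R}^2\to\mathbb{R}^3$ and the vector $\mathbf{b}\in\mathbb{R}^3$ are $$A = \begin{pmatrix}0 & 0\\ 0 & 1\\ 1 & 0\end{pmatrix},\qquad \mathbf{b} = \begin{pmatrix}-1\\0\\0\end{pmatrix},$$ and the second-order cone in $\mathbb{R}^3$ is $\mathcal{Q}^3 = \{\mathbf{y} = (y_1,y_2,y_3)\in\mathbb{R}^3 \mid y_3 \ge \sqrt{y_1^2+y_2^2}\}$. *)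

(* Defs.v *)
From HB Require Import structures.
From mathcomp Require Import all_boot all_order all_algebra.
From mathcomp Require Import all_classical reals topology normedtype.

Set Implicit Arguments.
Unset Strict Implicit.
Unset Printing Implicit Defensive.

Import Order.TTheory GRing.Theory Num.Theory.
Import numFieldNormedType.Exports.

Local Open Scope classical_set_scope.
Local Open Scope ring_scope.

(* Vectors are column vectors with coordinates indexed from 0, so the mathematical
   y_1, y_2, y_3 are [y 0 0], [y 1 0], [y 2 0]. *)

Definition Amx (R : realType) : 'M[R]_(3, 2) :=
  \matrix_(i < 3, j < 2)
    (nth [::] [:: [:: 0; 0];
                  [:: 0; 1];
                  [:: 1; 0]] i)`_j.

Definition bvec (R : realType) : 'cV[R]_3 :=
  \col_(i < 3) [:: -1; 0; 0]`_i.

Definition soc3 (R : realType) : set 'cV[R]_3 :=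
  [set y | Num.sqrt (y 0 0 ^+ 2 + y 1 0 ^+ 2) <= y 2 0].

Definition PhiP (R : realType) : set 'cV[R]_2 :=
  [set x | @soc3 R (Amx R *m x - bvec R)].

Definition fobj (R : realType) (x : 'cV[R]_2) : R := x 0 0 + x 1 0.

(* Main.v *)
Require Import Defs.
From HB Require Import structures.
From mathcomp Require Import all_boot all_order all_algebra.
From mathcomp Require Import all_classical reals topology normedtype.
From mathcomp Require Import ring lra.

Set Implicit Arguments.
Unset Strict Implicit.
Unset Printing Implicit Defensive.

Import Order.TTheory GRing.Theory Num.Theory.
Import numFieldNormedType.Exports.

Local Open Scope classical_set_scope.
Local Open Scope ring_scope.

(** Since [A x - b = (1, x2, x1)], the feasible set is the convex region
    [sqrt (1 + x2 ^ 2) <= x1] bounded by a branch of the hyperbola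
    [x1 ^ 2 - x2 ^ 2 = 1].  The functional [x1 + x2] vanishes on an asymptote
    of that branch: on the region [x1 > |x2|], so the functional is positive,
    while along the branch itself it takes every positive value, because
    [(x1 - x2) * (x1 + x2) = 1] can be solved with [x1 + x2 = t] for each
    [t > 0].  The infimum [0] is thus approached without being attained, and
    the image [(0, +oo)] misses its limit point [0]. *)

Lemma PhiPE (R : realType) (x : 'cV[R]_2) :
  PhiP x <-> Num.sqrt (1 + x 1 0 ^+ 2) <= x 0 0.
Proof.
rewrite /PhiP /soc3 /= !mxE !big_ord_recl !big_ord0 !mxE /=.
rewrite (_ : lift ord0 ord0 = 1); last exact: val_inj.
by rewrite !(mul0r, mul1r, addr0, add0r, subr0, opprK) expr1n.
Qed.

(** The cone condition forces [|x2| < x1], since the constant [1] under the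
    square root makes it strictly larger than [|x2|]. *)
Lemma fobj_PhiP_gt0 (R : realType) (x : 'cV[R]_2) : PhiP x -> 0 < fobj x.
Proof.
move=> /PhiPE xP; rewrite /fobj.
have : `|x 1 0| < x 0 0.
  apply: lt_le_trans xP.
  by rewrite -sqrtr_sqr ltr_sqrt ?ltrDr// ltr_pwDl ?sqr_ge0.
by rewrite ltr_norml => /andP[]; lra.
Qed.

(** The preimage of [t] is the point of the branch where [x1 + x2 = t] and
    [x1 - x2 = t^-1]. *)
Lemma fobj_PhiP_onto (R : realType) (t : R) :
  0 < t -> exists2 x, PhiP x & fobj x = t.
Proof.
move=> t0; have tV0 : 0 < t^-1 by rewrite invr_gt0.
have tn0 : t != 0 by rewrite gt_eqF.
exists (\col_i (if i == 0 then (t + t^-1) / 2 else (t - t^-1) / 2)).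
  apply/PhiPE; rewrite !mxE /=.
  have -> : 1 + ((t - t^-1) / 2) ^+ 2 = ((t + t^-1) / 2) ^+ 2 by field.
  by rewrite sqrtr_sqr ger0_norm //; lra.
by rewrite /fobj !mxE /=; field.
Qed.

Lemma not_closed_itvoy (R : realType) (a : R) : ~ closed `]a, +oo[%classic.
Proof.
move=> /(_ a); rewrite /= in_itv /= ltxx => aP; suff: false by [].
apply: aP => B /nbhs_ballP[e /= e0 eB].
exists (a + e / 2); split.
  by rewrite /= in_itv /= andbT; lra.
by apply: eB; rewrite /ball /= opprD addrA subrr add0r normrN gtr0_norm; lra.
Qed.

Theorem lemma4p2 (R : realType) :
  ~ closed (@fobj R @` @PhiP R) /\
  @fobj R @` @PhiP R = `]0, +oo[%classic.
Proof.
have imE : @fobj R @` @PhiP R = `]0, +oo[%classic.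
  apply/seteqP; split=> [_ [x xP <-] | t] /=; rewrite in_itv /= andbT.
    exact: fobj_PhiP_gt0.
  exact: fobj_PhiP_onto.
by split=> //; rewrite imE; exact: not_closed_itvoy.
Qed.
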